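(* Let $P_n$ be the natural unit interval order on $[n]$ such that $\mathrm{inc}(P_n)$ is a path, i.e. $i<_{P_n}j$ if and only if $j-i\ge 2$. Then for all partitions $\lambda\vdash n$, $$c_\lambda^{P_n}(q)=\sum_{T\in\mathrm{powST}_{P_n}(\lambda)}q^{\mathrm{inv}_{P_n}(T)}.$$
   Context: For a poset $P$ on $[n]$, $\mathrm{inc}(P)$ is the graph on $[n]$ with edges between distinct incomparable elements. For a graph $G$ on $[n]$, $X_G(\mathbf x,q)=\sum_\kappa q^{\mathrm{inv}_G(\kappa)}x_{\kappa(1)}\cdots x_{\kappa(n)}$ over proper colorings $\kappa:[n]\to\mathbb Z_{>0}$, where $\mathrm{inv}_G(\kappa)=\#\{\{i,j\}\in E(G): i<j,\ \kappa(i)>\kappa(j)\}$. For $P=P_n$ it is symmetric in $\mathbf x$; $c_\lambda^{P}(q)$ is the coefficient of the elementary symmetric function $e_\lambda(\mathbf x)$ in $X_{\mathrm{inc}(P)}(\mathbf x,q)$. Young diagrams are in English convention. A $P$-tableau of shape $\lambda$ is a filling $T:\lambda\to P$ with $T_{i,j}<_P T_{i+1,j}$ and $T_{i,j}\not>_P T_{i,j+1}$; it is standard if each element of $P$ appears exactly once. $\mathrm{inv}_P(T)=\#\{(i<j): i,j\text{ incomparable in }P,\ i\text{ appears in a column strictly to the right of the column of }j\text{ in }T\}$. A word $w_1\cdots w_k$ in $P$ is a powersum word if $w_i\not>_P w_{i+1}$ for all $i<k$ and there is no $i<k$ with $w_i<_Pw_j$ for all $j>i$. For a composition $\alpha=(\alpha_1,\dots,\alpha_l)$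 with positive parts, a powerful array of shape $\alpha$ is a filling $A$ of $\{(i,j):1\le j\le\alpha_i\}$ by elements of $P$ such that (1) each row is a powersum word; (2) $A_{r,t}<_PA_{s,t}$ whenever both cells exist and $r<s$; (3) $A_{r,\alpha_r}<_PA_{s,t}$ for all cells $(s,t)$ with $s>r$, $t>\alpha_r$. $\mathrm{tab}(A)$ is the filling of the partition $\mathrm{sort}(\alpha)$ (parts of $\alpha$ in decreasing order) obtained by pushing the entries of each column upward until top-justified. $\mathrm{powST}_P(\lambda)$ is the set of standard $P$-tableaux of shape $\lambda$ of the form $\mathrm{tab}(A)$ for a powerful array $A$. *)

(* Defs.v *)
From HB Require Import structures.
From mathcomp Require Import all_boot all_order all_algebra.
From mathcomp Require Export mpoly.
From mathcomp Require Import zify.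

Set Implicit Arguments.
Unset Strict Implicit.
Unset Printing Implicit Defensive.

Import GRing.Theory.
Local Open Scope nat_scope.

(* The ground set [n] = {1, ..., n} is represented by 'I_n = {0, ..., n-1},
   and rows and columns of diagrams are likewise numbered from 0. A poset on
   [n] is given by its strict order relation  P : rel 'I_n  (P i j: i <_P j). *)

Section Posets.
Variable n : nat.

(* The subtraction of nat is truncated, so this forces i < j. *)
Definition path_order : rel 'I_n := fun i j => 2 <= j - i.

Lemma path_order_irr : irreflexive path_order.
Proof. by move=> i; rewrite /path_order subnn. Qed.

Lemma path_order_trans : transitive path_order.
Proof. by move=> j i k; rewrite /path_order; lia. Qed.

Definition inc (P : rel 'I_n) : rel 'I_n :=
  fun i j => [&& i != j, ~~ P i j & ~~ P j i].

Lemma inc_path_order (i j : 'I_n) :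
  inc path_order i j = (i.+1 == j :> nat) || (j.+1 == i :> nat).
Proof. by rewrite /inc /path_order -val_eqE /=; lia. Qed.

End Posets.

(* Partitions and compositions are sequences of positive parts. *)
Definition is_partition (n : nat) (la : seq nat) : bool :=
  [&& sorted geq la, 0 \notin la & sumn la == n].

Definition partitions (n : nat) : seq (seq nat) :=
  [seq la <- [seq map val (b : n.-bseq 'I_n.+1) | b : n.-bseq 'I_n.+1]
     | is_partition n la].

Lemma partitions_uniq n : uniq (partitions n).
Proof.
rewrite filter_uniq // map_inj_uniq ?enum_uniq // => b c /= bc.
by apply: val_inj; apply: inj_map bc; apply: val_inj.
Qed.

Lemma sumn_ge_size s : 0 \notin s -> size s <= sumn s.
Proof.
elim: s => //= a s IH; rewrite inE negb_or => /andP[a0 /IH].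
by move=> ss; rewrite -add1n leq_add // lt0n eq_sym.
Qed.

Lemma mem_le_sumn s a : a \in s -> a <= sumn s.
Proof.
elim: s => //= b s IH; rewrite inE => /orP[/eqP->|/IH]; first exact: leq_addr.
by move=> /leq_trans; apply; apply: leq_addl.
Qed.

Lemma mem_partitions n la : (la \in partitions n) = is_partition n la.
Proof.
rewrite mem_filter; case: (boolP (is_partition n la)) => //= /and3P[_ la0 /eqP sla].
have sz : size (map (@inord n) la) <= n by rewrite size_map -sla sumn_ge_size.
apply/mapP; exists (Bseq sz); first by rewrite mem_enum.
rewrite /= -map_comp -[LHS]map_id; apply/eq_in_map => a la_a /=.
by rewrite inordK // ltnS -sla mem_le_sumn.
Qed.

Section Chromatic.
Variables (n : nat) (G : rel 'I_n).
Local Open Scope ring_scope.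

(* X_G(x, q) is a formal power series of bounded degree in x_1, x_2, ..., with
   coefficients in Z[q]. It is handled as the compatible family of its
   truncations to N variables (x_(N+1) = x_(N+2) = ... = 0), for all N: in the
   truncation, only the colorings with values in [N] remain. *)

Definition proper (N : nat) (kappa : {ffun 'I_n -> 'I_N}) : bool :=
  [forall i, forall j, G i j ==> (kappa i != kappa j)].

Definition inv_coloring (N : nat) (kappa : {ffun 'I_n -> 'I_N}) : nat :=
  #|[set ij : 'I_n * 'I_n |
      [&& (ij.1 < ij.2)%N, G ij.1 ij.2 & (kappa ij.2 < kappa ij.1)%N]]|.

Definition chromatic (N : nat) : {mpoly {poly int}[N]} :=
  \sum_(kappa : {ffun 'I_n -> 'I_N} | proper kappa)
     (('X : {poly int}) ^+ inv_coloring kappa) *: \prod_i 'X_(kappa i).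

Definition elementary (N : nat) (la : seq nat) : {mpoly {poly int}[N]} :=
  \prod_(k <- la) mesym N {poly int} k.

(* c gives the coefficients of the expansion of X_G(x, q) in the family of
   elementary symmetric functions; only its values on partitions of n matter. *)
Definition e_expansion (c : seq nat -> {poly int}) : Prop :=
  forall N : nat,
    chromatic N = \sum_(la <- partitions n) c la *: elementary N la.

End Chromatic.

Section Tableaux.
Variables (n : nat) (P : rel 'I_n).

(* The left-justified cells (r, t), t < al_r, for a sequence al of row
   lengths, weakly decreasing (Young diagrams) or not. *)
Definition cell (al : seq nat) := {r : 'I_(size al) & 'I_(nth 0 al r)}.

Definition row al (c : cell al) : nat := tag c.
Definition col al (c : cell al) : nat := tagged c.

Definition filling (al : seq nat) := {ffun cell al -> 'I_n}.

Definition is_tableau la (T : filling la) : bool :=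
  [forall c : cell la, forall d : cell la,
     ((row d == (row c).+1) && (col d == col c) ==> P (T c) (T d)) &&
     ((row d == row c) && (col d == (col c).+1) ==> ~~ P (T d) (T c))].

Definition standard la (T : filling la) : bool :=
  [forall i : 'I_n, #|[set c | T c == i]| == 1].

Definition inv_tableau la (T : filling la) : nat :=
  #|[set ij : 'I_n * 'I_n | [&& (ij.1 < ij.2), inc P ij.1 ij.2 &
      [exists c : cell la, exists d : cell la,
         [&& T c == ij.1, T d == ij.2 & col d < col c]]]]|.

Definition powersum_word k (w : 'I_k -> 'I_n) : bool :=
  [forall i : 'I_k, forall j : 'I_k, (j == i.+1 :> nat) ==> ~~ P (w j) (w i)] &&
  ~~ [exists i : 'I_k, (i.+1 < k) &&
        [forall j : 'I_k, (i < j) ==> P (w i) (w j)]].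

Definition powerful al (A : filling al) : bool :=
  [&& [forall r : 'I_(size al),
         powersum_word (fun t : 'I_(nth 0 al r) => A (existT _ r t))],
      [forall c : cell al, forall d : cell al,
         (col c == col d) && (row c < row d) ==> P (A c) (A d)] &
      [forall c : cell al, forall d : cell al,
         [&& (col c).+1 == nth 0 al (row c), row c < row d & col c < col d]
           ==> P (A c) (A d)]].

(* The row reached by cell c when all columns are pushed upward: the number of
   cells above c in its column. *)
Definition pushed_row al (c : cell al) : nat :=
  count (fun a => col c < a) (take (row c) al).

(* T = tab(A); cf. tab_exists_unique. *)
Definition is_tab al (A : filling al) la (T : filling la) : bool :=
  (la == sort geq al) &&
  [forall c : cell al, forall d : cell la,
     (row d == pushed_row c) && (col d == col c) ==> (T d == A c)].

(* The candidate compositions are listed as the permutations of la so that this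
   is a finite set; powSTP removes that bound. *)
Definition powST (la : seq nat) : {set filling la} :=
  [set T : filling la | [&& is_tableau T, standard T &
     has (fun al => (0 \notin al) &&
            [exists A : filling al, powerful A && is_tab A T])
         (permutations la)]].

Lemma powSTP la (T : filling la) :
  reflect [/\ is_tableau T, standard T &
             exists al (A : filling al), [/\ 0 \notin al, powerful A & is_tab A T]]
          (T \in powST la).
Proof.
rewrite inE; apply: (iffP and3P) => -[Ttab Tstd TA]; split=> //.
  have [al _ /andP[al0 /existsP[A /andP[Apow AT]]]] := hasP TA.
  by exists al, A.
have [al [A [al0 Apow AT]]] := TA; apply/hasP; exists al.
  have /andP[/eqP la_al _] := AT.
  by rewrite mem_permutations perm_sym la_al perm_sort.
by rewrite al0; apply/existsP; exists A; rewrite Apow.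
Qed.

Lemma sorted_count la t k :
  sorted geq la -> (t < nth 0 la k) = (k < count (fun a => t < a) la).
Proof.
have geq_trans : transitive geq by move=> a b c ba ac; apply: leq_trans ac ba.
elim: la k => [|a la IH] k; first by rewrite nth_nil.
move=> /= a_la; have la_s := path_sorted a_la.
have /allP a_max := order_path_min geq_trans a_la.
have [ta|at_] := ltnP t a; first by case: k => [|k] /=; rewrite ?ta //= IH.
have c0 : count (fun b => t < b) la = 0.
  apply/eqP; rewrite -leqn0 leqNgt -has_count -all_predC.
  by apply/allP => b /a_max /= ba; rewrite -leqNgt (leq_trans ba).
case: k => [|k] /=; first by rewrite c0; lia.
by rewrite IH // c0; lia.
Qed.

Lemma card_cell al : #|{: cell al}| = sumn al.
Proof.
rewrite card_tagged !sumnE [RHS](big_nth 0) big_mkord big_map big_enum /=.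
by apply: eq_bigr => r _; rewrite card_ord.
Qed.

Lemma cell_eq al (c d : cell al) : row c = row d -> col c = col d -> c = d.
Proof.
case: c d => [r t] [s u]; rewrite /row /col /= => /val_inj rs.
by case: _ / rs u => u /val_inj ->.
Qed.

Lemma cell_of al r t : t < nth 0 al r -> {c : cell al | row c = r & col c = t}.
Proof.
move=> tr; have rs : r < size al.
  by rewrite ltnNge; apply/negP => sr; rewrite nth_default in tr.
by exists (existT _ (Ordinal rs) (Ordinal tr : 'I_(nth 0 al (Ordinal rs)))).
Qed.

Lemma row_lt al (c : cell al) : row c < size al.
Proof. exact: ltn_ord. Qed.

Lemma col_lt al (c : cell al) : col c < nth 0 al (row c).
Proof. exact: (ltn_ord (tagged c)). Qed.

Lemma pushed_row_inj al (c d : cell al) :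
  pushed_row c = pushed_row d -> col c = col d -> c = d.
Proof.
suff le_row (c' d' : cell al) :
    pushed_row c' = pushed_row d' -> col c' = col d' -> row c' <= row d'.
  move=> rcd ccd; apply: cell_eq => //; apply/eqP.
  by rewrite eqn_leq !le_row.
move=> rcd ccd; rewrite leqNgt; apply/negP => dc; move: rcd.
rewrite /pushed_row ccd -(cat_take_drop (row d').+1 (take (row c') al)).
rewrite take_takel // (take_nth 0 (row_lt d')) count_cat -cats1 count_cat /=.
by rewrite col_lt; lia.
Qed.

Lemma pushed_row_lt al (c : cell al) : col c < nth 0 (sort geq al) (pushed_row c).
Proof.
have geq_total : total geq by move=> a b; rewrite /= leq_total.
rewrite (sorted_count _ _ (sort_sorted geq_total al)).
rewrite (permP (permEl (perm_sort _ _))) /pushed_row.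
have := congr1 (count (fun a => col c < a)) (cat_take_drop (row c) al).
by rewrite count_cat (drop_nth 0 (row_lt c)) /= col_lt; lia.
Qed.

Lemma tab_exists_unique al (A : filling al) :
  exists! T : filling (sort geq al), is_tab A T.
Proof.
pose push (c : cell al) : cell (sort geq al) := s2val (cell_of (pushed_row_lt c)).
have pushr c : row (push c) = pushed_row c by rewrite /push; case: cell_of.
have pushc c : col (push c) = col c by rewrite /push; case: cell_of.
have push_inj : injective push.
  by move=> c d cd; apply: pushed_row_inj; rewrite -?pushr -?pushc cd.
have card_push : #|{: cell (sort geq al)}| <= #|{: cell al}|.
  by rewrite !card_cell (perm_sumn (permEl (perm_sort _ _))).
have [pull pushK pullK] := inj_card_bij push_inj card_push.
have pushP c d : (row d == pushed_row c) && (col d == col c) = (d == push c).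
  apply/andP/eqP => [[/eqP rd /eqP cd]|->]; last by rewrite pushr pushc.
  by apply: cell_eq; rewrite ?pushr ?pushc.
exists [ffun d => A (pull d)]; split.
  rewrite /is_tab eqxx /=; apply/forallP => c; apply/forallP => d.
  by apply/implyP; rewrite pushP ffunE => /eqP->; rewrite pushK.
move=> T /andP[_ /forallP AT]; apply/ffunP => d; rewrite ffunE.
by have /forallP/(_ d) := AT (pull d); rewrite pushP pullK eqxx => /eqP->.
Qed.

End Tableaux.

(* Main.v *)
Require Import Defs.
From mathcomp Require Import all_boot all_order all_algebra.
From mathcomp Require Import mpoly.
From mathcomp Require Import zify ring.

Import GRing.Theory.

(** The coefficients on both sides are computed by the same recurrence,
which strips off one row of a powerful array.

Combinatorial side. In a powersum word with distinct letters over the path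
order a descent goes down by exactly one, and no letter but the last is two or
more below everything that follows. Adding letters from the right, one sees
that such a word is
  a, a+1, ..., a+j-1, a+j+l, a+j+l-1, ..., a+j,
so that a row is an interval together with a pair (j, l), called a hook here
([powersum_shape]). The column conditions force successive rows to fill
successive intervals ([hook_rows_shape]), and what remains of them is one
condition on neighbouring hooks: the largest entry of a row and the smallest
entry of the next row, which are incomparable, may not share a column, nor may
the former end its row with the latter further right ([compatibleP]). Conversely every compatible sequence of hooks gives a powerful
array ([array_powerful]) whose push-up is a tableau ([tab_tableau]).

Pushing up keeps columns, so the word listing the columns of 1, ..., n is the
same for the array and for its tableau; inv_P is its number of descents, since
only consecutive integers are incomparable. The word is a concatenation of hook
words, and one letter of look-ahead suffices to decode it
([hook_concat_inj]). Hence distinct arrays give distinct tableaux and the right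
hand side is a sum over compatible sequences of hooks
([powST_hook_coef]). When the first hook varies among those of size k, the sum
of its contributions is q[k-1]_q whatever the second hook is
([sum_compatible]), and it is [k]_q when there is no second hook. So the sum Y_n
of q^des e_(sizes) over compatible sequences of total size n satisfies
  Y_n = e_n + sum_(2 <= k <= n) q [k-1]_q e_k Y_(n-k).

Chromatic side. A coloring of the path is a word, it is proper when adjacent
letters differ, and inv counts its descents. Let a_i(z) be the generating
function of the words starting with i, and let U_i be 1 plus the sum of the a_j,
those with j < i being multiplied by q. Looking at the second letter gives
a_i = x_i z (U_i - a_i), whence U_(i+1) (1 + x_i z) = U_i (1 + q x_i z). The
product over all i telescopes to X(z) E(qz) = (1 - q + q X(z)) E(z), where E is
the generating function of the e_k; its coefficients are the same recurrence
multiplied by 1 - q ([word_sum_rec]).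

Finally the e_lambda with lambda a partition of n are linearly independent in n
variables ([elementary_free]), so that the coefficients are unique. *)

Set Implicit Arguments.
Unset Strict Implicit.
Unset Printing Implicit Defensive.

Local Notation row := Defs.row.
Local Notation col := Defs.col.

(** * Words counted by descents *)

Local Open Scope ring_scope.

Section WordSums.
Variables (R : comNzRingType) (N : nat) (q : R) (x : 'I_N -> R).

Definition esum (k : nat) : R := \sum_(h : {set 'I_N} | #|h| == k) \prod_(i in h) x i.

(** The factor contributed by two adjacent letters i, j of a word. *)
Definition step_weight (i j : 'I_N) : R :=
  if (i < j)%N then 1 else if (j < i)%N then q else 0.

Fixpoint word_sum_from (m : nat) (i : 'I_N) : R :=
  x i * (if m is m'.+1 then \sum_j step_weight i j * word_sum_from m' j else 1).

Definition word_sum (m : nat) : R :=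
  if m is m'.+1 then \sum_i word_sum_from m' i else 1.

Definition word_sum_from_gf n (i : 'I_N) : {poly R} :=
  \sum_(m < n) (word_sum_from m i)%:P * 'X ^+ m.+1.

(** The series of words starting with a given letter is handled through its
truncation at degree n; the last term is the error that this makes. *)
Lemma word_sum_from_gfE n i :
  word_sum_from_gf n i =
    (x i)%:P * 'X * (1 + \sum_j (step_weight i j)%:P * word_sum_from_gf n j)
    - (word_sum_from n i)%:P * 'X ^+ n.+1.
Proof.
apply/eqP; rewrite -subr_eq opprK; apply/eqP.
have -> : word_sum_from_gf n i + (word_sum_from n i)%:P * 'X ^+ n.+1 = word_sum_from_gf n.+1 i.
  by rewrite /word_sum_from_gf big_ord_recr.
rewrite /word_sum_from_gf big_ord_recl /= mulr1 expr1 mulrDr mulr1; congr (_ + _).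
under [in RHS]eq_bigr do rewrite mulr_sumr.
rewrite exchange_big /= mulr_sumr; apply: eq_bigr => m _.
rewrite polyCM rmorph_sum /= mulr_sumr mulr_suml mulr_sumr.
by apply: eq_bigr => j _; rewrite polyCM exprSr; ring.
Qed.

(** Interpolates between the series of all words (i = 0) and an affine function
of it (i = N); consecutive values have a rational ratio. *)
Definition tilt_gf n (i : nat) : {poly R} :=
  1 + \sum_(j : 'I_N) (if (i <= j)%N then 1 else q%:P) * word_sum_from_gf n j.

(** By the recurrence on first letters, a_i (1 + x_i z) = x_i z U_i up to order n,
while U_(i+1) - U_i = (q - 1) a_i by definition. *)
Lemma tilt_gfS n (i : 'I_N) :
  exists r, tilt_gf n i.+1 * (1 + (x i)%:P * 'X)
          = tilt_gf n i * (1 + (q * x i)%:P * 'X) + r * 'X ^+ n.+1.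
Proof.
have tiltS : tilt_gf n i.+1 = tilt_gf n i + (q%:P - 1) * word_sum_from_gf n i.
  rewrite /tilt_gf (bigD1 i) //= [in RHS](bigD1 i) //= ltnn leqnn.
  rewrite (eq_bigr (fun j : 'I_N => (if (i <= j)%N then 1 else q%:P) * word_sum_from_gf n j)).
    by ring.
  by move=> j ji; rewrite ltn_neqAle eq_sym val_eqE ji.
have wtE : \sum_j (step_weight i j)%:P * word_sum_from_gf n j
         = tilt_gf n i - 1 - word_sum_from_gf n i.
  rewrite /tilt_gf (bigD1 i) //= [in RHS](bigD1 i) //= leqnn /step_weight ltnn.
  rewrite (eq_bigr (fun j : 'I_N => (if (i <= j)%N then 1 else q%:P) * word_sum_from_gf n j)).
    by rewrite polyC0; ring.
  by move=> j ji; case: ltngtP ji => // /val_inj ->; rewrite eqxx.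
have := word_sum_from_gfE n i; rewrite wtE tiltS.
set a := word_sum_from_gf n i; set U := tilt_gf n i => aE.
(* The truncation error of a_i enters with the factor q - 1 of a_i in U_(i+1). *)
exists ((1 - q%:P) * (word_sum_from n i)%:P); rewrite polyCM.
have -> : (U + (q%:P - 1) * a) * (1 + (x i)%:P * 'X) =
  U * (1 + (x i)%:P * 'X) + (q%:P - 1) * (a + (x i)%:P * 'X * a) by ring.
rewrite {1}aE; ring.
Qed.

Definition elem_gf (y : 'I_N -> R) : {poly R} := \prod_i (1 + (y i)%:P * 'X).

Lemma coef_elem_gf (c : R) k : (elem_gf (fun i => c * x i))`_k = c ^+ k * esum k.
Proof.
rewrite /elem_gf; under eq_bigr do rewrite addrC.
rewrite bigA_distr coef_sum (bigID (fun h : {set 'I_N} => #|h| == k)) /=.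
rewrite [X in _ + X]big1 ?addr0.
  rewrite mulr_sumr; apply: eq_bigr => h /eqP <-.
  rewrite -big_mkcond /= big_split /= prodr_const -rmorph_prod coefMXn ltnn subnn.
  by rewrite big_split /= prodr_const coefC.
move=> h hk; rewrite -big_mkcond big_split /= prodr_const -rmorph_prod coefCM.
by rewrite coefXn eq_sym (negbTE hk) mulr0.
Qed.

(** The telescoping product of the previous ratios. *)
Lemma tilt_gf_total n :
  exists r, tilt_gf n N * elem_gf x
          = tilt_gf n 0 * elem_gf (fun i => q * x i) + r * 'X ^+ n.+1.
Proof.
suff /(_ N (leqnn N))[r] : forall i, (i <= N)%N -> exists r,
    tilt_gf n i * (\prod_(j : 'I_N | (j < i)%N) (1 + (x j)%:P * 'X))
    = tilt_gf n 0 * (\prod_(j : 'I_N | (j < i)%N) (1 + (q * x j)%:P * 'X)) + r * 'X ^+ n.+1.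
  by rewrite !(eq_bigl _ _ (@ltn_ord N)) => E; exists r.
elim=> [|i IH] iN; first by exists 0; rewrite !big_pred0 // mul0r addr0.
have [r rE] := IH (ltnW iN); have [s sE] := tilt_gfS n (Ordinal iN).
pose P y := \prod_(j : 'I_N | (j < i)%N) (1 + (y j)%:P * 'X) : {poly R}.
have PS y : \prod_(j : 'I_N | (j < i.+1)%N) (1 + (y j)%:P * 'X)
   = (1 + (y (Ordinal iN))%:P * 'X) * P y.
  rewrite (bigD1 (Ordinal iN)) /=; last by rewrite ltnS.
  congr (_ * _); apply: eq_bigl => j; rewrite -val_eqE /=; lia.
rewrite (PS x) (PS (fun j => q * x j)) -/(P x) in rE *.
rewrite -/(P (fun j => q * x j)) in rE *.
exists (s * P x + r * (1 + (q * x (Ordinal iN))%:P * 'X)).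
rewrite mulrA sE /=; set X := 'X ^+ _ in rE *.
transitivity ((tilt_gf n i * P x) * (1 + (q * x (Ordinal iN))%:P * 'X) + s * X * P x).
  by ring.
by rewrite rE; ring.
Qed.

Lemma coef_word_sum_from_gf n (i : 'I_N) m : (m <= n)%N ->
  (word_sum_from_gf n i)`_m = if m is m'.+1 then word_sum_from m' i else 0.
Proof.
move=> mn; rewrite /word_sum_from_gf coef_sum; case: m mn => [|m] mn.
  by rewrite big1 // => j _; rewrite coefMXn.
rewrite (bigD1 (Ordinal mn)) //= coefMXn ltnn subnn coefC eqxx.
rewrite big1 ?addr0 // => j; rewrite -val_eqE /= => jm; rewrite coefCM coefXn.
by rewrite eqSS eq_sym (negbTE jm) mulr0.
Qed.

Lemma coef_tilt_gf0 n m : (m <= n)%N -> (tilt_gf n 0)`_m = word_sum m.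
Proof.
move=> mn; rewrite /tilt_gf coefD coef1 coef_sum.
under eq_bigr do rewrite mul1r coef_word_sum_from_gf //.
by case: m mn => [|m] mn; [rewrite big1_eq addr0 | rewrite add0r].
Qed.

Lemma tilt_gfN n : tilt_gf n N = (1 - q)%:P + q%:P * tilt_gf n 0.
Proof.
rewrite /tilt_gf mulrDr mulr1 mulr_sumr addrA polyCB polyC1 subrK; congr (_ + _).
by apply: eq_bigr => j _; rewrite leqNgt ltn_ord /= mul1r.
Qed.

Lemma word_sum_esum n :
  \sum_(k < n.+1) q ^+ k * esum k * word_sum (n - k)
  = (1 - q) * esum n + \sum_(k < n.+1) q * esum k * word_sum (n - k).
Proof.
have [r] := tilt_gf_total n.
move=> /(congr1 (fun p : {poly R} => p`_n)); rewrite coefD coefMXn ltnSn addr0 => E.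
have {}E : (elem_gf x * tilt_gf n N)`_n = (elem_gf (fun i => q * x i) * tilt_gf n 0)`_n.
  by rewrite mulrC E mulrC.
have e1 k : (elem_gf x)`_k = esum k.
  rewrite -[RHS]mul1r -[in RHS](expr1n _ k) -coef_elem_gf /elem_gf.
  by under [in RHS]eq_bigr do rewrite mul1r.
transitivity (elem_gf (fun i => q * x i) * tilt_gf n 0)`_n.
  rewrite coefM; apply: eq_bigr => k _.
  by rewrite coef_elem_gf coef_tilt_gf0 ?leq_subr.
rewrite -E tilt_gfN mulrDr coefD coefMC e1 [esum n * _]mulrC; congr (_ + _).
rewrite mulrCA coefCM coefM mulr_sumr; apply: eq_bigr => k _.
by rewrite e1 coef_tilt_gf0 ?leq_subr // mulrA.
Qed.

Definition qint (k : nat) : R := \sum_(i < k) q ^+ i.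

End WordSums.

(** The coefficients of z^n in X(z) E(qz) = (1 - q + q X(z)) E(z), after division
by 1 - q: since (1 - q) [k]_q = 1 - q^k, the terms with factors q^k and q combine
into q-integers, and the term with factor e_1 disappears. *)
Lemma word_sum_rec (R : idomainType) N (q : R) (x : 'I_N -> R) n : q != 1 -> (0 < n)%N ->
  word_sum q x n = esum x n +
    \sum_(k < n) q * qint q k * esum x k.+1 * word_sum q x (n - k.+1).
Proof.
move=> q1 n0; have q1' : 1 - q != 0 by rewrite subr_eq0 eq_sym.
apply: (mulfI q1'); have := word_sum_esum q x n.
rewrite !big_ord_recl /= expr0 subn0.
have -> : esum x 0 = 1.
  rewrite /esum (big_pred1 set0) ?big_set0 // => h /=.
  by rewrite cards_eq0.
rewrite mulr1 !mul1r mulr1 => E.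
rewrite mulrDr [X in _ = _ + X]mulr_sumr.
have T k : (1 - q) * (q * qint q k * esum x k.+1 * word_sum q x (n - k.+1)) =
   q * esum x k.+1 * word_sum q x (n - k.+1) - q ^+ k.+1 * esum x k.+1 * word_sum q x (n - k.+1).
  have := subrXX 1 q k; rewrite expr1n => G.
  have {}G : 1 - q ^+ k = (1 - q) * qint q k.
    by rewrite G; congr (_ * _); apply: eq_bigr => i _; rewrite expr1n mul1r.
  transitivity (((1 - q) * qint q k) * (q * esum x k.+1 * word_sum q x (n - k.+1))); first by ring.
  by rewrite -G exprS; ring.
under eq_bigr do rewrite T.
rewrite sumrB.
move: E; rewrite /bump /=.
set S1 := \sum_(_ < _) _; set S2 := \sum_(_ < _) _ => E.
match goal with |- _ = ?e + (?A - ?B) => change (A - B) with (S2 - S1) end.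
have -> : (1 - q) * word_sum q x n = (word_sum q x n + S1) - q * word_sum q x n - S1 by ring.
rewrite E; ring.
Qed.

(** * Proper colorings of the path *)

Local Open Scope ring_scope.

Fixpoint des (s : seq nat) : nat :=
  if s is a :: s' then ((if s' is b :: _ then b < a else false) + des s')%N else 0%N.

Lemma desE (s : seq nat) :
  des s = (\sum_(i < size s) ((i.+1 < size s) && (nth 0 s i.+1 < nth 0 s i)))%N.
Proof.
elim: s => [|a s IH] /=; first by rewrite big_ord0.
by rewrite big_ord_recl /= IH; congr (_ + _)%N; case: s {IH}.
Qed.

(** Incomparable means consecutive in the path order, so the inversions of a
labelling are the descents of the word that it spells. It is applied to
colorings and to the column labelling of a tableau. *)
Lemma card_descents n (c : 'I_n -> nat) :
  #|[set ij : 'I_n * 'I_n | [&& (ij.1 < ij.2)%N, inc (@path_order n) ij.1 ij.2 &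
        (c ij.2 < c ij.1)%N]]| = des [seq c i | i <- enum 'I_n].
Proof.
rewrite desE size_map size_enum_ord cardsE -sum1_card big_mkcond /=.
transitivity (\sum_(i < n) \sum_(j < n) ((i.+1 == j :> nat) && (c j < c i) : nat))%N.
  rewrite pair_big /=; apply: eq_bigr => -[i j] _ /=.
  rewrite unfold_in /= inc_path_order; case: (c j < c i)%N; rewrite ?andbF // !andbT.
  by case: (ltngtP i j) => /= ij; do ?case: eqP => //=; lia.
apply: eq_bigr => i _; have nthc (j : 'I_n) : nth 0%N [seq c k | k <- enum 'I_n] j = c j.
  by rewrite (nth_map j) ?size_enum_ord // nth_ord_enum.
have [iSn|nSi] := ltnP i.+1 n; last first.
  by rewrite big1 // => j _; have := ltn_ord j; case: eqP => // <-; lia.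
rewrite (bigD1 (Ordinal iSn)) //= eqxx big1 ?addn0 /=.
  by rewrite nthc -(nthc (Ordinal iSn)).
by move=> j; rewrite -val_eqE /= eq_sym => /negbTE ->.
Qed.

Definition ffcons (T : Type) m (a : T) (g : {ffun 'I_m -> T}) : {ffun 'I_m.+1 -> T} :=
  [ffun i => if unlift ord0 i is Some j then g j else a].

Lemma codom_ffcons (T : Type) m (a : T) (g : {ffun 'I_m -> T}) :
  codom (ffcons a g) = a :: codom g.
Proof.
rewrite /codom /image_mem !enum_ordSl /= ffunE unlift_none -map_comp; congr (_ :: _).
by apply: eq_map => i /=; rewrite ffunE liftK.
Qed.

Lemma big_ffun_recl (R : nmodType) (T : finType) m (F : {ffun 'I_m.+1 -> T} -> R) :
  \sum_f F f = \sum_a \sum_(g : {ffun 'I_m -> T}) F (ffcons a g).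
Proof.
rewrite pair_big /=.
rewrite (reindex (fun p : T * {ffun 'I_m -> T} => ffcons p.1 p.2)) //=.
exists (fun f : {ffun 'I_m.+1 -> T} => (f ord0, [ffun i => f (lift ord0 i)])) => [[a g]|f] _ /=.
  rewrite ffunE unlift_none; congr (_, _).
  by apply/ffunP => i; rewrite !ffunE liftK.
by apply/ffunP => i; rewrite !ffunE; case: unliftP => [j|] ->; rewrite ?ffunE.
Qed.

Section ColoringWords.
Variables (R : comNzRingType) (N : nat) (q : R) (x : 'I_N -> R).

Fixpoint word_weight (s : seq 'I_N) : R :=
  if s is a :: s' then
    x a * ((if s' is b :: _ then step_weight q a b else 1) * word_weight s')
  else 1.

Lemma word_sum_fromE m i :
  word_sum_from q x m i = \sum_(g : {ffun 'I_m -> 'I_N}) word_weight (i :: codom g).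
Proof.
elim: m i => [|m IH] i.
  rewrite (big_pred1 (ffun0 (card_ord 0))) /=; last first.
    by move=> g; apply/esym/eqP/ffunP => -[].
  by rewrite /codom /image_mem enum_ord0 /= !mulr1.
rewrite big_ffun_recl /= mulr_sumr; apply: eq_bigr => j _.
rewrite IH !mulr_sumr; apply: eq_bigr => g _.
by rewrite codom_ffcons.
Qed.

Lemma word_sumE m : word_sum q x m = \sum_(f : {ffun 'I_m -> 'I_N}) word_weight (codom f).
Proof.
case: m => [|m] /=.
  rewrite (big_pred1 (ffun0 (card_ord 0))) /=; last by move=> g; apply/esym/eqP/ffunP => -[].
  by rewrite /codom /image_mem enum_ord0.
rewrite big_ffun_recl; apply: eq_bigr => i _; rewrite word_sum_fromE.
by apply: eq_bigr => g _; rewrite codom_ffcons.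
Qed.

Lemma word_weightE (s : seq 'I_N) :
  word_weight s = if sorted (fun a b => a != b) s
                  then q ^+ des (map val s) * \prod_(i <- s) x i else 0.
Proof.
elim: s => [|a [|b s] IH]; rewrite ?big_nil ?mulr1 //= ?big_cons ?big_nil ?addn0 ?expr0 ?mul1r //.
rewrite -/(word_weight (b :: s)) {}IH /= big_cons.
case: path; last by rewrite !mulr0 andbF.
rewrite andbT /step_weight -val_eqE; case: ltngtP => /= _; rewrite ?mul0r ?mulr0 //.
  by rewrite add0n; ring.
by rewrite !exprD expr1; ring.
Qed.

End ColoringWords.

Lemma proper_path n N (f : {ffun 'I_n -> 'I_N}) :
  Defs.proper (inc (@path_order n)) f = sorted (fun a b => a != b) (codom f).
Proof.
have nthf (i j0 : 'I_n) : nth (f j0) (codom f) i = f i.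
  by rewrite (nth_map i) ?size_enum_ord // nth_ord_enum.
apply/'forall_forallP/idP => [fP|].
  case: n f fP nthf => [|n] f fP nthf; first by rewrite /codom /image_mem enum_ord0.
  apply/(sortedP (f ord0)) => i; rewrite size_codom card_ord => iSn.
  have /implyP := fP (Ordinal (ltnW iSn)) (Ordinal iSn).
  by rewrite -(nthf _ ord0) -[f (Ordinal iSn)](nthf _ ord0); apply; rewrite inc_path_order eqxx.
move=> sf i j; apply/implyP; rewrite inc_path_order.
wlog: i j / i.+1 = j :> nat => [W /orP[]/eqP ij|]; first by apply: W; rewrite ij ?eqxx.
  by rewrite eq_sym; apply: W; rewrite ij ?eqxx.
move=> ij _; move/(sortedP (f i)): sf => /(_ i).
by rewrite size_codom card_ord ij !nthf; apply.
Qed.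

(** Reading the colors along the path turns proper colorings into words without
equal adjacent letters, and inversions into descents. *)
Lemma chromatic_word_sum n N :
  chromatic (inc (@path_order n)) N = word_sum (('X : {poly int})%:MP) (fun i => 'X_i) n.
Proof.
rewrite /chromatic word_sumE big_mkcond; apply: eq_bigr => f _.
rewrite word_weightE proper_path; case: ifP => // _.
rewrite -mul_mpolyC rmorphXn; congr (_ ^+ _ * _).
  rewrite /inv_coloring /= (card_descents (fun i => val (f i))).
  by rewrite /codom /image_mem -map_comp.
by rewrite /codom /image_mem big_map big_enum.
Qed.

(** * Sequences of hooks *)

Local Open Scope nat_scope.

(** A hook is a pair p = (j, l). Its word is 0, ..., j-1, j+l, j+l-1, ..., j, and
it encodes a row of a powerful array in two ways: as the entries of the row,
counted from the smallest, and as the columns of these entries listed by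
increasing entry. The two readings agree since the word is an involution
([hook_wordK]). *)
Definition hook_len (p : nat * nat) : nat := (p.1 + p.2).+1.
Definition hook_word (p : nat * nat) : seq nat := iota 0 p.1 ++ rev (iota p.1 p.2.+1).
Definition first_letter (p : nat * nat) : nat := if 0 < p.1 then 0 else p.2.

(** When p' follows p, the largest entry of the row of p sits in column p.1 and
the smallest entry of the next row in column [first_letter p']. These entries are
incomparable, so they may not share a column, nor may the former be the last of
its row while the latter lies further right; taking the minimum with the last
column covers both cases. *)
Definition compatible (p p' : nat * nat) : bool :=
  p.1 != minn (p.1 + p.2) (first_letter p').
Definition hook_concat (s : seq (nat * nat)) : seq nat := flatten (map hook_word s).
Definition compatible_seq (s : seq (nat * nat)) : bool := sorted compatible s.

Lemma size_hook_word p : size (hook_word p) = hook_len p.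
Proof. by rewrite size_cat size_rev !size_iota /hook_len addnS. Qed.

Lemma nth_hook_word p t : t < hook_len p ->
  nth 0 (hook_word p) t = if t < p.1 then t else p.1.*2 + p.2 - t.
Proof.
rewrite /hook_len => tp; rewrite nth_cat size_iota; case: ltnP => jt.
  by rewrite nth_iota.
by rewrite nth_rev ?size_iota ?nth_iota; lia.
Qed.

Lemma hook_wordK p t : t < hook_len p ->
  nth 0 (hook_word p) (nth 0 (hook_word p) t) = t.
Proof.
move=> tp; have := tp; rewrite /hook_len => tp'.
rewrite (nth_hook_word tp); case: ltnP => jt; rewrite nth_hook_word /hook_len;
  by try case: ltnP; lia.
Qed.

Lemma nth_hook_word_lt p t : t < hook_len p -> nth 0 (hook_word p) t < hook_len p.
Proof.
move=> tp; rewrite nth_hook_word //; move: tp; rewrite /hook_len.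
by case: (ltnP t p.1); lia.
Qed.

Lemma des_cat s b t :
  des (s ++ b :: t) = (if s is a :: s' then des s + (b < last a s') else 0) + des (b :: t).
Proof.
case: s => [|a s] //; elim: s a => [|c s IH] a; first by rewrite /= addn0.
by rewrite [LHS]/= -/(des (c :: s ++ b :: t)) -cat_cons IH /= !addnA.
Qed.

Lemma des_iota a m : des (iota a m) = 0.
Proof. by elim: m a => // m IH a; rewrite /= IH; case: m {IH} => //= m; rewrite ltnNge leqnSn. Qed.

Lemma rev_iotaS a m : rev (iota a m.+1) = a + m :: rev (iota a m).
Proof. by rewrite -addn1 iotaD rev_cat. Qed.

Lemma des_rev_iota a m : des (rev (iota a m.+1)) = m.
Proof.
elim: m => // m; rewrite (rev_iotaS a m.+1) (rev_iotaS a m) => IH.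
by rewrite -[LHS]/((a + m < a + m.+1) + des (a + m :: rev (iota a m))) IH; lia.
Qed.

Lemma hook_word_cons p : exists w, hook_word p = first_letter p :: w.
Proof.
case: p => [[|j] l]; rewrite /hook_word /first_letter /=; last by eexists.
by rewrite -/(iota 0 l.+1) rev_iotaS; eexists.
Qed.

Lemma last_hook_word p a : last a (hook_word p) = p.1.
Proof. by rewrite last_cat /= rev_cons last_rcons. Qed.

Lemma des_hook_word p : des (hook_word p) = p.2.
Proof.
case: p => j l; rewrite /hook_word /=.
have := des_rev_iota j l; rewrite rev_iotaS => E.
rewrite des_cat E; case: j {E} => // j.
rewrite -[LHS]/(des (iota 0 j.+1) + (j.+1 + l < last 0 (iota 1 j)) + l) des_iota.
suff : last 0 (iota 1 j) <= j by lia.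
by case: j => // j; rewrite (last_nth 0) size_iota -[nth _ _ _]/(nth 0 (iota 1 j.+1) j) nth_iota.
Qed.

(** A hook word ends with p.1, which yields one more descent exactly when the next
hook word starts lower. *)
Lemma des_hook_concat_cons p s :
  des (hook_concat (p :: s)) =
    p.2 + (if s is p' :: _ then first_letter p' < p.1 else false) + des (hook_concat s).
Proof.
rewrite /hook_concat /=; case: s => [|p' s] /=; first by rewrite cats0 des_hook_word !addn0.
have [w ->] := hook_word_cons p'; rewrite cat_cons des_cat -[in RHS](des_hook_word p).
have := last_hook_word p 0; have [v ->] /= := hook_word_cons p.
by move=> <-.
Qed.

Section QSums.
Variables (R : comNzRingType) (q : R).
Local Open Scope ring_scope.

(** The key cancellation: exactly one value m of j is excluded, with m = min(K, h)
where h is the first letter of p', and skipping it compensates for the descent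
at the junction. Below m the exponent is K - j; above m the junction is a descent
(m = h there) and the exponent is K - j + 1. In both cases the surviving values
give each of the exponents 1, ..., K once, independently of p'. *)
Lemma sum_compatible p' K :
  \sum_(j < K.+1 | compatible (j : nat, K - j)%N p') q ^+ (K - j + (first_letter p' < j))
  = q * qint q K.
Proof.
have mK : (minn K (first_letter p') < K.+1)%N by lia.
rewrite (eq_bigl (fun j : 'I_K.+1 => j != Ordinal mK)); last first.
  by move=> j; rewrite /compatible /= -val_eqE /= subnKC // -ltnS.
transitivity (\sum_(i < K) q ^+ (K - i)).
  rewrite (reindex_omap (lift (Ordinal mK)) (unlift (Ordinal mK))) /=; last first.
    by move=> j; case: unliftP => //= [i ->|->]; rewrite ?eqxx.
  apply: eq_big => [i|i _]; first by rewrite liftK eqxx andbT eq_sym neq_lift.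
  by congr (_ ^+ _); rewrite /= /bump; have := ltn_ord i; lia.
rewrite /qint mulr_sumr (reindex_inj rev_ord_inj) /=; apply: eq_bigr => i _.
by rewrite -exprS; congr (_ ^+ _); have := ltn_ord i; lia.
Qed.

Definition hook_seq_weight (s : seq (nat * nat)) : R :=
  if compatible_seq s then q ^+ des (hook_concat s) else 0.

(** Without a second hook nothing is excluded and there is no junction: the sum
over j is then [K+1]_q = q [K]_q + 1. *)
Lemma sum_hook_seq_weight_cons K s :
  \sum_(j < K.+1) hook_seq_weight ((j : nat, K - j)%N :: s)
  = q * qint q K * hook_seq_weight s + (s == [::])%:R.
Proof.
rewrite /hook_seq_weight; case: s => [|p' s].
  rewrite /= mulr1; under eq_bigr do rewrite des_hook_concat_cons !addn0 /=.
  rewrite (reindex_inj rev_ord_inj) /= big_ord_recl /= subSS subn0 subnn.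
  rewrite expr0 addrC /qint mulr_sumr; congr (_ + _); apply: eq_bigr => i _.
  by rewrite -exprS; congr (_ ^+ _); rewrite /bump; have := ltn_ord i; lia.
rewrite addr0 /compatible_seq /= -big_mkcond /=; case: path; last first.
  by rewrite mulr0 big1 // => j; rewrite andbF.
rewrite -(sum_compatible p') mulr_suml; apply: eq_big => [j|j _]; first by rewrite andbT.
by rewrite des_hook_concat_cons -exprD.
Qed.

End QSums.

Definition hooks_upto n : seq (nat * nat) :=
  [seq (j, k - j) | k <- iota 0 n, j <- iota 0 k.+1].

(** All sequences of hooks of total size n, provided that n <= f: the argument f
is a bound on the depth of the recursion. *)
Fixpoint hook_seqs f n : seq (seq (nat * nat)) :=
  if n is 0 then [:: [::]] else
  if f is f'.+1 then [seq p :: s | p <- hooks_upto n, s <- hook_seqs f' (n - hook_len p)]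
  else [::].

Lemma hook_seqs0 f : hook_seqs f 0 = [:: [::]].
Proof. by case: f. Qed.

Lemma hook_seqsS f n :
  hook_seqs f.+1 n.+1 = [seq p :: s | p <- hooks_upto n.+1, s <- hook_seqs f (n.+1 - hook_len p)].
Proof. by []. Qed.

Lemma mem_hooks_upto n p : (p \in hooks_upto n) = (hook_len p <= n).
Proof.
case: p => j l; rewrite /hook_len /=; apply/allpairsPdep/idP => [[k [i []]]|jl].
  by rewrite !mem_iota => ? ? [-> ->]; lia.
by exists (j + l), j; rewrite !mem_iota; split; try lia; congr (_, _); lia.
Qed.

Lemma uniq_hooks_upto n : uniq (hooks_upto n).
Proof.
apply: allpairs_uniq_dep => [|k _|[k j] [k' j']]; rewrite ?iota_uniq //.
move=> /allpairsPdep[a [b [_ + [? ?]]]] /allpairsPdep[a' [b' [_ + [? ?]]]]; subst.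
by rewrite !mem_iota /= => bj bj' [jj kk]; subst; congr existT; lia.
Qed.

Lemma mem_hook_seqs f n s : n <= f -> (s \in hook_seqs f n) = (sumn (map hook_len s) == n).
Proof.
elim: f n s => [|f IH] [|n] s // nf; try by rewrite hook_seqs0; case: s.
rewrite hook_seqsS.
apply/allpairsPdep/eqP => [[p [t [+ + ->]]]|].
  by rewrite mem_hooks_upto => pn; rewrite IH => [/eqP /= ->|]; move: pn; rewrite /hook_len; lia.
case: s => [|p s] //= pE; exists p, s; rewrite mem_hooks_upto IH; first split=> //.
- by rewrite -pE leq_addr.
- by rewrite -pE addKn.
by move: pE nf; rewrite /hook_len; lia.
Qed.

Lemma uniq_hook_seqs f n : uniq (hook_seqs f n).
Proof.
elim: f n => [|f IH] [|n] //; rewrite hook_seqsS.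
apply: allpairs_uniq_dep => //; first exact: uniq_hooks_upto.
by move=> [p s] [p' s'] _ _ [-> ->].
Qed.

(** Stripping off the first hook shows that this sum obeys the recurrence
characterizing W. *)
Lemma sum_hook_seqs (R : comNzRingType) (q : R) (e W : nat -> R) :
  (W 0 = 1)%R ->
  (forall n : nat, (0 < n)%N ->
     W n = e n + \sum_(k < n) q * qint q k * e k.+1 * W (n - k.+1)%N)%R ->
  forall f n, n <= f ->
  (\sum_(s <- hook_seqs f n) hook_seq_weight q s * \prod_(k <- map hook_len s) e k = W n)%R.
Proof.
move=> W0 WS; elim=> [|f IH] [|n] nf //.
- by rewrite /= big_seq1 big_nil mulr1 /hook_seq_weight /= expr0 W0.
- by rewrite /= big_seq1 big_nil mulr1 /hook_seq_weight /= expr0 W0.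
rewrite hook_seqsS big_allpairs_dep /hooks_upto big_allpairs_dep.
rewrite WS // -[iota 0 n.+1]/(index_iota 0 n.+1) big_mkord.
transitivity (\sum_(k < n.+1) (q * qint q k * e k.+1 * W (n.+1 - k.+1)%N
     + (n == k :> nat)%:R * e k.+1))%R; last first.
  rewrite big_split /= addrC; congr (_ + _)%R.
  rewrite (bigD1 ord_max) //= eqxx mul1r big1 ?addr0 // => i.
  by rewrite -val_eqE /= eq_sym => /negbTE ->; rewrite mul0r.
apply: eq_bigr => k _; rewrite -[iota 0 k.+1]/(index_iota 0 k.+1) big_mkord.
have lenk (j : 'I_k.+1) : hook_len (j : nat, k - j) = k.+1.
  by rewrite /hook_len /= subnKC // -ltnS.
under eq_bigr do under eq_bigr do rewrite /= lenk big_cons mulrCA.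
under eq_bigr do rewrite lenk -mulr_sumr.
rewrite -mulr_sumr exchange_big /=.
under eq_bigr do rewrite -mulr_suml sum_hook_seq_weight_cons mulrDl -mulrA.
rewrite big_split /= -mulr_sumr IH; last by lia.
rewrite mulrDr; congr (_ + _)%R; first by rewrite mulrA [(e _ * _)%R]mulrC.
rewrite [RHS]mulrC; congr (_ * _)%R.
have [<-|nk] := eqVneq n k.
  by rewrite subnn hook_seqs0 big_seq1 big_nil mulr1.
rewrite big_seq big1 // => s; rewrite mem_hook_seqs; last by lia.
by case: s => [/= |*]; rewrite ?mul0r //; have := ltn_ord k; lia.
Qed.

(** * Rows made of hooks *)

Local Open Scope nat_scope.

Lemma size_hook_concat s : size (hook_concat s) = sumn (map hook_len s).
Proof.
rewrite size_flatten /shape -map_comp; congr sumn.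
by apply: eq_map => p /=; rewrite size_hook_word.
Qed.

Lemma nth_hook_concat_head p s t : t < hook_len p ->
  nth 0 (hook_concat (p :: s)) t = nth 0 (hook_word p) t.
Proof. by move=> tp; rewrite /hook_concat /= nth_cat size_hook_word tp. Qed.

Lemma nth_hook_concat_next p p' s :
  nth 0 (hook_concat [:: p, p' & s]) (hook_len p) = first_letter p'.
Proof.
rewrite /hook_concat /= nth_cat size_hook_word ltnn subnn.
by have [w ->] := hook_word_cons p'.
Qed.

(** If p'.1 were larger than j = p.1, the second reading would have the letter j
at place j and a letter above j at place j + 1. The former forces p = (j, 0); but
then, by compatibility, the next hook word starts below j, unless the word ends
there. *)
Lemma hook_concat_head_le p p' s s' : compatible_seq (p :: s) ->
  hook_concat (p :: s) = hook_concat (p' :: s') -> p'.1 <= p.1.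
Proof.
move=> ps E; rewrite leqNgt; apply/negP => jj.
have Wj : nth 0 (hook_word p) p.1 = nth 0 (hook_word p') p.1.
  by rewrite -(@nth_hook_concat_head p s) ?E ?nth_hook_concat_head // /hook_len; lia.
have l0 : p.2 = 0.
  by move: Wj; rewrite !nth_hook_word /hook_len ?ltnn ?jj; lia.
case: s ps E => [|p2 s] ps E.
  by have := congr1 size E; rewrite !size_hook_concat /= /hook_len; lia.
have := nth_hook_concat_next p p2 s; rewrite E /hook_len l0 addn0.
rewrite nth_hook_concat_head ?nth_hook_word /hook_len; try lia.
move: ps => /andP[+ _]; rewrite /compatible l0 addn0.
case: ltnP; lia.
Qed.

Lemma hook_concat_inj s s' : compatible_seq s -> compatible_seq s' ->
  hook_concat s = hook_concat s' -> s = s'.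
Proof.
elim: s s' => [|p s IH] [|p' s'] vs vs' E //.
- by have := congr1 size E; rewrite !size_hook_concat /= /hook_len.
- by have := congr1 size E; rewrite !size_hook_concat /= /hook_len.
have pp : p = p'.
  have j1 := hook_concat_head_le vs E; have j2 := hook_concat_head_le vs' (esym E).
  have jj : p.1 = p'.1 by lia.
  have : nth 0 (hook_word p) p.1 = nth 0 (hook_word p') p.1.
    by rewrite -(@nth_hook_concat_head p s) ?E ?nth_hook_concat_head // /hook_len; lia.
  rewrite !nth_hook_word /hook_len -?jj ?ltnn; try lia.
  by case: p p' jj {vs vs' E j1 j2} => [j l] [j' l'] /= -> H; congr (_, _); lia.
rewrite -pp in E vs' *; congr cons; apply: IH (path_sorted vs) (path_sorted vs') _.
by move/eqP: E; rewrite /hook_concat /= eqseq_cat // eqxx => /eqP.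
Qed.

(** The second condition on powersum words over the path order, for words of
natural numbers. *)
Fixpoint no_strict_min (w : seq nat) : bool :=
  if w is x :: w' then (w' == [::]) || (has (fun y => y < x.+2) w' && no_strict_min w')
  else true.

Lemma map_hook_word a p :
  map (addn a) (hook_word p) = iota a p.1 ++ rev (iota (a + p.1) p.2.+1).
Proof. by rewrite /hook_word map_cat map_rev -!iotaDl addn0. Qed.

(** By induction from the right. Let the tail be the hook (j, l) filling the
interval [a, b], and let x be the letter put in front. Some letter of the tail is
at most x + 1, so a <= x + 1; as x is outside [a, b], either x = a - 1, which
lengthens j, or x > b. In the latter case x exceeds the next letter by at most
one, so that letter is b, which means that j = 0, and x = b + 1 lengthens l. *)
Lemma powersum_shape (w : seq nat) : w != [::] -> uniq w ->
  sorted (fun x y => x < y.+2) w -> no_strict_min w ->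
  exists a p, w = map (addn a) (hook_word p).
Proof.
elim: w => // x [|y w] IH _.
  by exists x, (0, 0); rewrite /= addn0.
rewrite cons_uniq => /andP[xw uw].
move=> /= /andP[xy sw] /andP[xmin nw]; have [a [[j l] E]] := IH isT uw sw nw.
have {}xmin : has (fun z => z < x.+2) (y :: w) := xmin.
have Ey : y = if 0 < j then a else a + l.
  have := congr1 (head 0) E; have [v ->] := hook_word_cons (j, l).
  by rewrite /first_letter /= => ->; case: ifP => _; rewrite ?addn0.
rewrite E map_hook_word -[(j, l).1]/j -[(j, l).2]/l in xw xmin *.
have inw z : (z \in iota a j ++ rev (iota (a + j) l.+1)) = (a <= z < a + j + l.+1).
  by rewrite mem_cat mem_rev !mem_iota; clear; lia.
rewrite inw in xw; have /hasP[z] := xmin; rewrite inw => az zx.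
have [xa|ax] := ltnP x a.
  exists x, (j.+1, l); rewrite map_hook_word (_ : a = x.+1); last by move: xa az zx; clear; lia.
  by rewrite addSnnS.
have j0 : j = 0 by move: Ey xy xw ax; clear; case: ifP; lia.
subst j; exists a, (0, l.+1); rewrite addn0 in xw az *.
rewrite map_hook_word addn0 [RHS](rev_iotaS a l.+1); congr cons.
by move: Ey xy xw ax => /=; clear; lia.
Qed.

(** Conditions (2) and (3) on powerful arrays, for two rows: a row is continued
to the right by repeating its last entry. *)
Definition dominates (r s : seq nat) : bool :=
  all (fun t => nth 0 r (minn t (size r).-1) + 2 <= nth 0 s t) (iota 0 (size s)).

Lemma nth_map_hook_word a p t : t < hook_len p ->
  nth 0 (map (addn a) (hook_word p)) t = a + nth 0 (hook_word p) t.
Proof. by move=> tp; rewrite (nth_map 0) ?size_hook_word. Qed.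

Lemma nth_hook_word0 p : nth 0 (hook_word p) 0 = first_letter p.
Proof. by have [w ->] := hook_word_cons p. Qed.

Lemma first_letter_lt p : first_letter p < hook_len p.
Proof. by rewrite -nth_hook_word0 nth_hook_word_lt. Qed.

Lemma nth_hook_word_last p : nth 0 (hook_word p) (hook_len p).-1 = p.1.
Proof. by rewrite nth_hook_word /hook_len /=; [case: ltnP|]; lia. Qed.

Lemma minn_lt_hook_len p t : minn t (hook_len p).-1 < hook_len p.
Proof. by rewrite /hook_len /=; lia. Qed.

(** Two rows filling successive intervals of integers can only fail to dominate
at the largest entry of the first and the smallest of the second; as the hook word
is an involution, these are found in columns p.1 and [first_letter p']. *)
Lemma compatibleP p p' :
  reflect (forall t, t < hook_len p' ->
             nth 0 (hook_word p) (minn t (hook_len p).-1) + 2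
             <= hook_len p + nth 0 (hook_word p') t)
          (compatible p p').
Proof.
apply: (iffP idP) => [pp t tp'|H].
  rewrite leqNgt; apply/negP => bad; have B := nth_hook_word_lt (minn_lt_hook_len p t).
  have e1 : nth 0 (hook_word p) (minn t (hook_len p).-1) = (hook_len p).-1 by lia.
  have e2 : nth 0 (hook_word p') t = 0 by lia.
  have := hook_wordK (minn_lt_hook_len p t); rewrite e1 nth_hook_word_last => pE.
  have := hook_wordK tp'; rewrite e2 nth_hook_word0 => tE.
  by move: pp; rewrite /compatible tE -[p.1 + p.2]/(hook_len p).-1 minnC pE eqxx.
apply/eqP => pE; have := H _ (first_letter_lt p').
rewrite minnC -[(hook_len p).-1]/(p.1 + p.2) -pE.
have -> : nth 0 (hook_word p') (first_letter p') = 0 by rewrite -nth_hook_word0 hook_wordK.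
by rewrite nth_hook_word /hook_len ?ltnn /=; lia.
Qed.

Lemma dominates_compatible a p p' :
  dominates (map (addn a) (hook_word p)) (map (addn (a + hook_len p)) (hook_word p'))
  = compatible p p'.
Proof.
rewrite /dominates !size_map !size_hook_word; apply/allP/compatibleP => H t.
  move=> tp'; have := H t; rewrite mem_iota tp' => /(_ isT).
  by rewrite !nth_map_hook_word ?minn_lt_hook_len //; lia.
rewrite mem_iota => /andP[_ tp']; have := H _ tp'.
by rewrite !nth_map_hook_word ?minn_lt_hook_len //; lia.
Qed.

Fixpoint hook_rows (a : nat) (s : seq (nat * nat)) : seq (seq nat) :=
  if s is p :: s' then map (addn a) (hook_word p) :: hook_rows (a + hook_len p) s' else [::].

Lemma perm_map_hook_word a p : perm_eq (map (addn a) (hook_word p)) (iota a (hook_len p)).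
Proof.
by rewrite map_hook_word /hook_len -addnS iotaD perm_cat2l perm_rev.
Qed.

Definition powersum_row (w : seq nat) : bool :=
  [&& w != [::], sorted (fun x y => x < y.+2) w & no_strict_min w].

(** Domination makes every entry of a later row exceed some entry of the first
row, so the first row contains the smallest entry. Being an interval, it takes an
initial segment of the entries, and the argument applies to the other rows. *)
Lemma hook_rows_shape (rs : seq (seq nat)) a :
  perm_eq (flatten rs) (iota a (size (flatten rs))) ->
  all powersum_row rs ->
  pairwise dominates rs -> exists2 s, compatible_seq s & rs = hook_rows a s.
Proof.
elim: rs a => [|r rs IH] a; first by exists [::].
move=> Prs /= /andP[/and3P[r0 sr nr] ars] /andP[dr drs].
have Urs : uniq (flatten (r :: rs)) by rewrite (perm_uniq Prs) iota_uniq.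
have ur : uniq r by move: Urs; rewrite /= cat_uniq => /and3P[].
have [b [p rE]] := powersum_shape r0 ur sr nr.
have ge_a z : z \in flatten (r :: rs) -> a <= z.
  by rewrite (perm_mem Prs) mem_iota => /andP[].
have mem_r z : (z \in r) = (b <= z < b + hook_len p).
  by rewrite rE (perm_mem (perm_map_hook_word b p)) mem_iota.
have size_r : size r = hook_len p by rewrite rE size_map size_hook_word.
(* If the minimum a were in a later row, domination would give an entry below it. *)
have ab : b = a.
  apply/eqP; rewrite eqn_leq (ge_a b) ?andbT; last first.
    by rewrite /= mem_cat mem_r /hook_len; apply/orP; left; lia.
  have : a \in flatten (r :: rs).
    by rewrite (perm_mem Prs) mem_iota /= size_cat size_r /hook_len; lia.
  rewrite /= mem_cat mem_r => /orP[/andP[]//|/flattenP[r' r'rs ar']].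
  have /allP/(_ (index a r')) := allP dr _ r'rs.
  rewrite mem_iota /= index_mem nth_index // => /(_ ar').
  rewrite size_r => le_a; have := minn_lt_hook_len p (index a r'); rewrite -{2}size_r.
  move=> /(mem_nth 0); set z := nth 0 r _ in le_a * => zr.
  have : a <= z by apply: ge_a; rewrite /= mem_cat zr.
  by move: le_a; clear; lia.
subst b; have Prs' : perm_eq (flatten rs) (iota (a + hook_len p) (size (flatten rs))).
  move: Prs; rewrite /= size_cat size_r iotaD => Prs.
  rewrite -(perm_cat2l r) (perm_trans Prs) // perm_cat2r perm_sym rE.
  exact: perm_map_hook_word.
have [s vs rsE] := IH _ Prs' ars drs.
exists (p :: s); last by rewrite rE rsE.
move: dr; rewrite rsE; case: s vs {rsE} => //= p' s vs /andP[+ _].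
by rewrite rE dominates_compatible /compatible_seq /= => ->.
Qed.

Definition array_entry (s : seq (nat * nat)) (r t : nat) : nat :=
  sumn (take r (map hook_len s)) + nth 0 (hook_word (nth (0, 0) s r)) t.

Lemma nth_hook_rows a s r t : r < size s -> t < hook_len (nth (0, 0) s r) ->
  nth 0 (nth [::] (hook_rows a s) r) t = a + array_entry s r t.
Proof.
elim: s a r => // p s IH a [|r] /=; rewrite ltnS => rs tr.
  by rewrite nth_map_hook_word.
by rewrite IH // /array_entry /=; lia.
Qed.

Lemma shape_hook_rows a s : shape (hook_rows a s) = map hook_len s.
Proof. by elim: s a => //= p s IH a; rewrite -/(shape _) IH size_map size_hook_word. Qed.

(** This is where the two readings of a hook word, as entries and as columns, meet
([hook_wordK]). *)
Lemma nth_hook_concat s r t : r < size s -> t < hook_len (nth (0, 0) s r) ->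
  nth 0 (hook_concat s) (array_entry s r t) = t.
Proof.
elim: s r => // p s IH [|r] /=; rewrite ltnS => rs tr.
  by rewrite /array_entry /= nth_hook_concat_head ?nth_hook_word_lt // hook_wordK.
rewrite /array_entry /= -addnA /hook_concat /= nth_cat size_hook_word ltnNge leq_addr /= addKn.
exact: IH.
Qed.

Lemma hook_word_step p t : t.+1 < hook_len p ->
  nth 0 (hook_word p) t < (nth 0 (hook_word p) t.+1).+2.
Proof.
move=> tp; rewrite !nth_hook_word ?(ltnW tp) //; move: tp; rewrite /hook_len; clear.
by case: (ltnP t p.1); case: (ltnP t.+1 p.1); lia.
Qed.

Lemma hook_word_later p t : t.+1 < hook_len p -> exists t',
  [/\ t < t', t' < hook_len p & nth 0 (hook_word p) t' <= (nth 0 (hook_word p) t).+1].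
Proof.
move=> tp; have [tj|jt] := ltnP t p.1.
  exists (nth 0 (hook_word p) t.+1); rewrite nth_hook_word_lt // hook_wordK //.
  rewrite !nth_hook_word // ?tj ?(ltnW tp) //; split=> //.
  by move: tp tj; rewrite /hook_len; case: (ltnP t.+1 p.1); lia.
exists t.+1; split=> //; rewrite !nth_hook_word ?(ltnW tp) //.
by rewrite !ltnNge jt (leq_trans jt) //=; move: tp; rewrite /hook_len; lia.
Qed.

Lemma array_entry_lt s r t : r < size s -> t < hook_len (nth (0, 0) s r) ->
  array_entry s r t < sumn (take r.+1 (map hook_len s)).
Proof.
move=> rs ts; rewrite (take_nth 0) ?size_map // sumn_rcons /array_entry (nth_map (0, 0)) //.
by rewrite ltn_add2l nth_hook_word_lt.
Qed.

Lemma sumn_take_le (l : seq nat) r r' : r <= r' -> sumn (take r l) <= sumn (take r' l).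
Proof.
move=> rr'; rewrite -(cat_take_drop r (take r' l)) sumn_cat take_takel //; exact: leq_addr.
Qed.

Lemma array_entry_lt_rows s r t r' t' : r < r' -> r' < size s ->
  t < hook_len (nth (0, 0) s r) -> array_entry s r t < array_entry s r' t'.
Proof.
move=> rr' rs ts; apply: leq_trans (array_entry_lt (ltn_trans rr' rs) ts) _.
by apply: leq_trans (sumn_take_le _ rr') _; rewrite leq_addr.
Qed.

(** Rows that are not adjacent are separated by a nonempty interval, so that only
neighbours need compatibility. *)
Lemma array_entry_dominates s r t r' : compatible_seq s -> r < r' -> r' < size s ->
  t < hook_len (nth (0, 0) s r') ->
  (array_entry s r (minn t (hook_len (nth (0, 0) s r)).-1)).+2 <= array_entry s r' t.
Proof.
move=> vs rr' rs ts; have tr := minn_lt_hook_len (nth (0, 0) s r) t.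
have [r'E|r'r] := eqVneq r' r.+1.
  subst r'; have /(sortedP (0, 0))/(_ r rs)/compatibleP/(_ t ts) := vs.
  rewrite /array_entry (take_nth 0) ?size_map ?(ltn_trans _ rs) // sumn_rcons.
  by rewrite (nth_map (0, 0)) ?(ltn_trans _ rs) //; clear; lia.
have r2 : r.+1 < r' by rewrite ltn_neqAle eq_sym r'r.
apply: leq_trans (@array_entry_lt_rows s r.+1 0 r' t r2 rs _); last by rewrite /hook_len.
by rewrite ltnS array_entry_lt_rows // (ltn_trans r2).
Qed.


(** * Powerful arrays *)

Local Open Scope nat_scope.

Lemma no_strict_minP w :
  (forall i, i.+1 < size w -> exists j, [/\ i < j, j < size w & nth 0 w j < (nth 0 w i).+2]) ->
  no_strict_min w.
Proof.
elim: w => //= x w IH H; apply/orP; case: eqP => [|/eqP w0]; [by left | right].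
apply/andP; split.
  have w_gt0 : 0 < size w by rewrite lt0n size_eq0.
  have [[|j] [// _ jw xj]] := H 0 w_gt0.
  by apply/hasP; exists (nth 0 w j); rewrite ?mem_nth.
by apply: IH => i iw; have [[|j] [// ij jw xj]] := H i.+1 iw; exists j.
Qed.

Section Fillings.
Variable n : nat.
Local Notation P := (@path_order n).

Definition is_array s al (A : filling n al) : Prop :=
  map hook_len s = al /\ forall c, A c = array_entry s (row c) (col c) :> nat.

Section Powerful.
Variables (al : seq nat) (A : filling n al).

(** Total functions of natural numbers replace the dependent cells, so that the
results on sequences of rows apply; 0 is a default outside the array. *)
Definition entry r t : nat :=
  if [pick c : cell al | (row c == r) && (col c == t)] is Some c then A c else 0.

Lemma entryE c : entry (row c) (col c) = A c.
Proof.
rewrite /entry; case: pickP => [d /andP[/eqP rd /eqP cd]|/(_ c)]; last by rewrite !eqxx.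
by rewrite (cell_eq rd cd).
Qed.

Definition array_rows : seq (seq nat) :=
  mkseq (fun r => mkseq (entry r) (nth 0 al r)) (size al).

Lemma nth_array_rows c : nth 0 (nth [::] array_rows (row c)) (col c) = A c.
Proof. by rewrite nth_mkseq ?row_lt // nth_mkseq ?col_lt // entryE. Qed.

Lemma shape_array_rows : shape array_rows = al.
Proof.
rewrite /shape -map_comp; apply: (@eq_from_nth _ 0); rewrite ?size_map ?size_iota // => r ral.
by rewrite (nth_map 0) ?size_iota // nth_iota //= size_mkseq.
Qed.

Lemma powerful_rowP r : powerful P A -> r < size al -> 0 \notin al ->
  powersum_row (mkseq (entry r) (nth 0 al r)).
Proof.
move=> /and3P[/forallP rowP _ _] ral al0; set w := mkseq _ _.
have nthw t : t < nth 0 al r -> exists t' : 'I_(nth 0 al (Ordinal ral)),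
    t' = t :> nat /\ nth 0 w t = A (existT _ (Ordinal ral) t').
  move=> tr; exists (Ordinal (tr : t < nth 0 al (Ordinal ral))); split=> //.
  by rewrite nth_mkseq // -[RHS]entryE.
have /andP[/forallP steps /existsPn nomin] := rowP (Ordinal ral).
have sw : size w = nth 0 al r by rewrite size_mkseq.
apply/and3P; split.
- rewrite -size_eq0 sw; apply: contraNneq al0 => <-; exact: mem_nth.
- apply/(sortedP 0) => t; rewrite sw => tr.
  have [t1 [t1E ->]] := nthw _ (ltnW tr); have [t2 [t2E ->]] := nthw _ tr.
  have /forallP/(_ t2)/implyP := steps t1; rewrite t1E t2E eqxx => /(_ isT).
  by rewrite /path_order; lia.
apply: no_strict_minP => t; rewrite sw => tr.
have [t1 [t1E ->]] := nthw _ (ltnW tr).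
have := nomin t1; rewrite t1E tr /= => /forallPn[t2]; rewrite negb_imply => /andP[t12].
rewrite /path_order => N; exists t2; rewrite t12 ltn_ord; split=> //.
have [t3 [/val_inj -> ->]] := nthw _ (ltn_ord t2).
by move: N; rewrite -leqNgt leq_subLR addn1 -ltnS.
Qed.

Lemma powerful_dominates : 0 \notin al -> powerful P A -> pairwise dominates array_rows.
Proof.
move=> al0 /and3P[_ /forallP colP /forallP lastP].
apply/(pairwiseP [::]) => r r'; rewrite !inE /array_rows size_mkseq => ral ral' rr'.
rewrite /array_rows (nth_mkseq [::] _ ral) (nth_mkseq [::] _ ral').
apply/allP => t; rewrite mem_iota !size_mkseq => /andP[_ tr'].
have [d rd cd] := cell_of tr'.
have al_r : 0 < nth 0 al r.
  by rewrite lt0n; apply: contraNneq al0 => <-; apply: mem_nth.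
have tr : minn t (nth 0 al r).-1 < nth 0 al r by lia.
have [c rc cc] := cell_of tr.
rewrite !nth_mkseq // -{1}cc -{1}rc -cd -rd !entryE.
have /forallP/(_ d)/implyP colcd := colP c; have /forallP/(_ d)/implyP lastcd := lastP c.
suff : P (A c) (A d) by rewrite /path_order; lia.
case: (ltnP t (nth 0 al r)) => tt; [apply: colcd | apply: lastcd].
  by rewrite cc cd rc rd rr' andbT; apply/eqP; lia.
by rewrite cc cd rc rd rr'; lia.
Qed.

(** A filling of n cells in which every element occurs is standard, so its rows
satisfy [hook_rows_shape]. *)
Lemma powerful_array : 0 \notin al -> sumn al = n -> (forall i, exists c, A c = i) ->
  powerful P A -> exists2 s, compatible_seq s & is_array s A.
Proof.
move=> al0 sal Asurj Apow.
have size_flat : size (flatten array_rows) = n by rewrite size_flatten shape_array_rows.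
have sub_flat : {subset iota 0 n <= flatten array_rows}.
  move=> i; rewrite mem_iota => /= in_; have [c Ac] := Asurj (Ordinal in_).
  apply/flattenP; exists (nth [::] array_rows (row c)).
    by rewrite mem_nth // size_mkseq row_lt.
  have -> : i = nth 0 (nth [::] array_rows (row c)) (col c) by rewrite nth_array_rows Ac.
  by rewrite mem_nth // nth_mkseq ?row_lt // size_mkseq col_lt.
have Prs : perm_eq (flatten array_rows) (iota 0 (size (flatten array_rows))).
  rewrite size_flat perm_sym.
  have sz : size (flatten array_rows) <= size (iota 0 n) by rewrite size_flat size_iota.
  have [_ mem_flat] := uniq_min_size (iota_uniq 0 n) sub_flat sz.
  exact: uniq_perm (iota_uniq 0 n) (leq_size_uniq (iota_uniq 0 n) sub_flat sz) mem_flat.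
have Rrows : all powersum_row array_rows.
  by apply/allP => w /mapP[r]; rewrite mem_iota => ral ->; apply: powerful_rowP.
have [s vs rsE] := hook_rows_shape Prs Rrows (powerful_dominates al0 Apow).
exists s => //; have sE : map hook_len s = al by rewrite -(shape_hook_rows 0) -rsE shape_array_rows.
split=> // c; have rc : row c < size s by rewrite -(size_map hook_len) sE row_lt.
have lenE : hook_len (nth (0, 0) s (row c)) = nth 0 al (row c).
  by rewrite -(nth_map _ 0 hook_len) // sE.
by rewrite -nth_array_rows rsE nth_hook_rows // lenE col_lt.
Qed.

End Powerful.


Section ArrayOfHooks.
Variables (s : seq (nat * nat)) (al : seq nat) (A : filling n al).
Hypotheses (s_valid : compatible_seq s) (sA : is_array s A).

Let row_lt_s (c : cell al) : row c < size s.
Proof. by rewrite -(size_map hook_len) (proj1 sA) row_lt. Qed.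

Let len_row (c : cell al) : nth 0 al (row c) = hook_len (nth (0, 0) s (row c)).
Proof. by rewrite -(nth_map _ 0 hook_len) // (proj1 sA). Qed.

Let col_lt_len (c : cell al) : col c < hook_len (nth (0, 0) s (row c)).
Proof. by rewrite -len_row col_lt. Qed.

Lemma array_lt_rows (c d : cell al) : row c < row d -> A c < A d.
Proof. by have [_ AE] := sA; move=> cd; rewrite !AE array_entry_lt_rows. Qed.

Lemma array_dominates (c d : cell al) : row c < row d ->
  col c = minn (col d) (nth 0 al (row c)).-1 -> P (A c) (A d).
Proof.
have [_ AE] := sA; move=> cd; rewrite len_row => cE.
have := array_entry_dominates s_valid cd (row_lt_s d) (col_lt_len d).
by rewrite -cE -!AE /path_order; clear; lia.
Qed.

Lemma array_step (c d : cell al) : row d = row c -> col d = (col c).+1 -> ~~ P (A d) (A c).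
Proof.
have [_ AE] := sA; move=> rdc cdc; rewrite /path_order !AE rdc cdc /array_entry.
have := col_lt_len d; rewrite rdc cdc => /hook_word_step.
by clear; lia.
Qed.

Lemma array_powerful : powerful P A.
Proof.
have [_ AE] := sA; apply/and3P; split.
- apply/forallP => r; apply/andP; split.
    apply/forallP => t; apply/forallP => t'; apply/implyP => /eqP tt'.
    exact: (@array_step (existT _ r t) (existT _ r t')).
  apply/existsPn => t; rewrite negb_and; apply/orP.
  have [tr|] := ltnP t.+1 (nth 0 al r); [right | by left].
  have lenE : nth 0 al r = hook_len (nth (0, 0) s r) := len_row (existT _ r t).
  have tr' : t.+1 < hook_len (nth (0, 0) s r) by rewrite -lenE.
  have [t' [tt' + pE]] := hook_word_later tr'; rewrite -lenE => t'r.
  apply/forallPn; exists (Ordinal t'r).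
  rewrite negb_imply /= tt' /path_order !AE /array_entry /row /col /=.
  by move: pE; clear; lia.
- apply/forallP => c; apply/forallP => d; apply/implyP => /andP[/eqP cd rcd].
  by apply: array_dominates => //; rewrite -cd; have := col_lt c; clear; lia.
apply/forallP => c; apply/forallP => d; apply/implyP => /and3P[/eqP cE rcd cd].
by apply: array_dominates => //; move: cE cd; clear; lia.
Qed.

End ArrayOfHooks.

End Fillings.

(** * Tableaux obtained from powerful arrays *)

Local Open Scope nat_scope.

Lemma count_take_le (l : seq nat) (f : pred nat) r r' : r <= r' ->
  count f (take r l) <= count f (take r' l).
Proof.
by move=> rr'; rewrite -[take r' l](cat_take_drop r) count_cat take_takel // leq_addr.
Qed.

Section Tabs.
Variable n : nat.
Local Notation P := (@path_order n).

(** The cell map underlying the push-up: it is injective as the column and the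
number of cells above determine a cell, and the two shapes have the same size. *)
Lemma tab_push al (A : filling n al) la (T : filling n la) : is_tab A T ->
  exists push : cell al -> cell la,
    [/\ bijective push, forall c, row (push c) = pushed_row c,
        forall c, col (push c) = col c & forall c, T (push c) = A c].
Proof.
case/andP => /eqP laE; subst la => /forallP TA.
pose push (c : cell al) : cell (sort geq al) := s2val (cell_of (pushed_row_lt c)).
have pushr c : row (push c) = pushed_row c by rewrite /push; case: cell_of.
have pushc c : col (push c) = col c by rewrite /push; case: cell_of.
exists push; split=> // [|c]; last first.
  by have /forallP/(_ (push c)) := TA c; rewrite pushr pushc !eqxx => /eqP.
apply: inj_card_bij => [c d cd|].
  by apply: pushed_row_inj; rewrite -?pushr -?pushc cd.
by rewrite !card_cell (perm_sumn (permEl (perm_sort _ _))).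
Qed.

Lemma standard_bij la (T : filling n la) : standard T <-> bijective T.
Proof.
split=> [/forallP Tstd | [T' TK T'K]].
  have Tinj : injective T.
    move=> c d cd; have /cards1P[e eE] := Tstd (T c).
    have : c \in [set e] by rewrite -eE inE.
    have : d \in [set e] by rewrite -eE inE cd.
    by rewrite !inE => /eqP -> /eqP.
  have Tsurj i : {c | T c == i}.
    by apply/sigW; have /cards1P[e /setP/(_ e)] := Tstd i; rewrite !inE eqxx; exists e.
  exists (fun i => sval (Tsurj i)) => [c|i]; last by apply/eqP; case: Tsurj.
  by apply: Tinj; apply/eqP; case: Tsurj.
apply/forallP => i; apply/cards1P; exists (T' i); apply/setP => c; rewrite !inE.
by apply/eqP/eqP => [<-|->].
Qed.

Definition column_of la (T : filling n la) (i : 'I_n) : nat :=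
  if [pick c | T c == i] is Some c then col c else 0.

Lemma column_ofE la (T : filling n la) c : injective T -> column_of T (T c) = col c.
Proof.
move=> Tinj; rewrite /column_of; case: pickP => [d /eqP/Tinj -> //|/(_ c)].
by rewrite eqxx.
Qed.

Definition column_word la (T : filling n la) : seq nat := [seq column_of T i | i <- enum 'I_n].

Lemma inv_tableau_des la (T : filling n la) : bijective T ->
  inv_tableau P T = des (column_word T).
Proof.
move=> Tbij; have Tinj := bij_inj Tbij; rewrite -card_descents; apply: eq_card => -[i j].
rewrite !inE /=; congr [&& _, _ & _]; have [T' TK T'K] := Tbij.
apply/existsP/idP => [[c /existsP[d /and3P[/eqP <- /eqP <-]]]|].
  by rewrite !column_ofE.
rewrite -(T'K i) -(T'K j) !column_ofE // => ij.
by exists (T' i); apply/existsP; exists (T' j); rewrite !eqxx.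
Qed.

Section TabOfArray.
Variables (s : seq (nat * nat)) (al la : seq nat) (A : filling n al) (T : filling n la).
Hypotheses (sA : is_array s A) (AT : is_tab A T).

Lemma array_inj : injective A.
Proof.
have [sal AE] := sA.
have row_le (c d : cell al) : A c = A d -> row c <= row d.
  move=> cd; rewrite leqNgt; apply/negP => dc.
  by have := array_lt_rows sA dc; rewrite cd ltnn.
move=> c d cd; have rcd : row c = row d by apply/eqP; rewrite eqn_leq !row_le.
apply: cell_eq => //; have := congr1 val cd; rewrite /= !AE /array_entry -rcd => /addnI E.
have lenE : hook_len (nth (0, 0) s (row c)) = nth 0 al (row c).
  by rewrite -(nth_map _ 0 hook_len) ?sal // -(size_map hook_len) sal row_lt.
rewrite -(@hook_wordK (nth (0, 0) s (row c)) (col c)) ?E ?hook_wordK // lenE ?col_lt //.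
by rewrite rcd col_lt.
Qed.

(** Pushing up preserves the order of the cells of a column, which gives the
column condition. Two horizontal neighbours of the push-up come from rows r <= r'
of the array, because a row reaching the right column also counts for the left
one; if r < r' the entries are ordered as the intervals are, and if r = r' they are
neighbours in the array. *)
Lemma tab_tableau : compatible_seq s -> is_tableau P T.
Proof.
move=> s_valid; have [push [[pull pushK pullK] pushr pushc TE]] := tab_push AT.
apply/forallP => e; apply/forallP => f; rewrite -(pullK e) -(pullK f) !TE !pushr !pushc.
move: (pull e) (pull f) => c d; apply/andP; split; apply/implyP => /andP[/eqP rdc /eqP cdc].
  have rcd : row c < row d.
    rewrite ltnNge; apply/negP => /(count_take_le al (fun a => col c < a)).
    by move: rdc; rewrite /pushed_row cdc => ->; rewrite ltnn.
  by apply: (array_dominates s_valid sA rcd); rewrite cdc;have := col_lt c; lia.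
have rcd : row c <= row d.
  rewrite leqNgt; apply/negP => /(count_take_le al (fun a => col c < a)).
  rewrite (take_nth 0) ?row_lt // -cats1 count_cat /=.
  have cd : col c < nth 0 al (row d) by apply: leq_trans (col_lt d); rewrite cdc.
  have : count (fun a => col d < a) (take (row d) al)
      <= count (fun a => col c < a) (take (row d) al).
    by apply: sub_count => a /=; rewrite cdc; apply: ltnW.
  by move: rdc; rewrite /pushed_row cd; lia.
have [rcd'|rdc'] := ltnP (row c) (row d).
  by have := array_lt_rows sA rcd'; rewrite /path_order; lia.
by apply: (array_step sA) => //; apply/eqP; rewrite eqn_leq rcd rdc'.
Qed.

Hypothesis sum_s : sumn (map hook_len s) = n.

Lemma array_bij : bijective A.
Proof.
have [sal _] := sA; apply: inj_card_bij array_inj _.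
by rewrite card_ord card_cell -sal sum_s.
Qed.

Lemma tab_bij : bijective T.
Proof.
have [push [[pull pushK pullK] _ _ TE]] := tab_push AT; have [A' AK A'K] := array_bij.
exists (push \o A') => [c|i] /=; last by rewrite TE A'K.
by rewrite -{1}(pullK c) TE AK pullK.
Qed.

Lemma column_word_tab : column_word T = hook_concat s.
Proof.
have [push [_ _ pushc TE]] := tab_push AT; have [A' _ A'K] := array_bij.
have [sal AE] := sA; have Tinj := bij_inj tab_bij.
apply: (@eq_from_nth _ 0) => [|i]; rewrite size_map size_enum_ord ?size_hook_concat // => i_n.
rewrite (nth_map (Ordinal i_n)) ?size_enum_ord // (nth_ord_enum _ (Ordinal i_n)).
set c := A' (Ordinal i_n); have Ac : A c = Ordinal i_n by apply: A'K.
rewrite -{1}Ac -TE column_ofE // pushc (_ : i = A c); last by rewrite Ac.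
have rc : row c < size s by rewrite -(size_map hook_len) sal row_lt.
by rewrite AE nth_hook_concat // -(nth_map _ 0 hook_len) // sal col_lt.
Qed.

End TabOfArray.

Lemma array_exists s : sumn (map hook_len s) = n ->
  exists A : filling n (map hook_len s), is_array s A.
Proof.
move=> sn.
have lt_n (c : cell (map hook_len s)) : array_entry s (row c) (col c) < n.
  have rc : row c < size s by rewrite -(size_map hook_len) row_lt.
  rewrite -[X in _ < X]sn -[in X in _ < X](take_size (map hook_len s)).
  apply: leq_trans (array_entry_lt rc _) _; last by rewrite sumn_take_le // size_map.
  by rewrite -(nth_map _ 0 hook_len) // col_lt.
exists [ffun c => Ordinal (lt_n c)]; split=> // c; by rewrite ffunE.
Qed.

Lemma powST_array la (T : filling n la) : T \in powST P la ->
  exists2 s, compatible_seq s & exists al (A : filling n al),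
    [/\ sumn (map hook_len s) = n, is_array s A & is_tab A T].
Proof.
move=> /powSTP[_ /standard_bij[T' TK T'K] [al [A [al0 Apow AT]]]].
have [push [[pull pushK pullK] _ _ TE]] := tab_push AT.
have sal : sumn al = n.
  rewrite -card_cell -[RHS]card_ord; apply: (@bij_eq_card _ _ A).
  exists (pull \o T') => [c|i] /=; first by rewrite -TE TK pushK.
  by rewrite -TE pullK T'K.
have Asurj i : exists c, A c = i by exists (pull (T' i)); rewrite -TE pullK T'K.
have [s vs sA] := powerful_array al0 sal Asurj Apow.
by exists s => //; exists al, A; split=> //; rewrite (proj1 sA).
Qed.

Lemma powST_word la (T : filling n la) : T \in powST P la ->
  exists s, [/\ compatible_seq s, sumn (map hook_len s) = n, sort geq (map hook_len s) = la &
                column_word T = hook_concat s].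
Proof.
move=> /powST_array[s vs [al [A [sn sA AT]]]]; exists s; split=> //.
  by rewrite (proj1 sA); case/andP: AT => /eqP.
exact: column_word_tab sA AT sn.
Qed.

Lemma word_powST s : compatible_seq s -> sumn (map hook_len s) = n ->
  exists2 T : filling n (sort geq (map hook_len s)), 
    T \in powST P _ & column_word T = hook_concat s.
Proof.
move=> vs sn; have [A sA] := array_exists sn.
have [T [AT _]] := tab_exists_unique A; exists T; last exact: column_word_tab sA AT sn.
apply/powSTP; split; first exact: (tab_tableau sA AT vs).
  by apply/standard_bij; apply: tab_bij sA AT sn.
exists (map hook_len s), A; split=> //; last exact: array_powerful vs sA.
by apply/mapP => -[p _].
Qed.

(** The word of columns determines the sequence of hooks, hence the array and its
push-up. *)
Lemma column_word_inj la : {in powST P la &, injective (@column_word la)}.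
Proof.
move=> T1 T2 /powST_array[s1 vs1 [al1 [A1 [sn1 sA1 AT1]]]].
move=> /powST_array[s2 vs2 [al2 [A2 [sn2 sA2 AT2]]]].
rewrite (column_word_tab sA1 AT1 sn1) (column_word_tab sA2 AT2 sn2).
move=> /(hook_concat_inj vs1 vs2) s12; subst s2.
have [E1 AE1] := sA1; have [E2 AE2] := sA2; subst al1; subst al2.
have A12 : A1 = A2 by apply/ffunP => c; apply: val_inj; rewrite /= AE1 AE2.
subst A2; have /andP[/eqP laE _] := AT1; subst la.
have [T [_ Tuniq]] := tab_exists_unique A1.
by rewrite -(Tuniq _ AT1) -(Tuniq _ AT2).
Qed.

End Tabs.

(** * The elementary expansion *)

Local Open Scope ring_scope.

Lemma geq_sorted_perm_eq (la mu : seq nat) :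
  sorted geq la -> sorted geq mu -> perm_eq la mu -> la = mu.
Proof.
apply: sorted_eq => [a b c ba ac|a b ab]; first exact: leq_trans ac ba.
by apply/eqP; rewrite eqn_leq andbC.
Qed.

Lemma sort_geq_sorted (la : seq nat) : sorted geq (sort geq la).
Proof. by apply: sort_sorted => a b /=; rewrite leq_total. Qed.

Section Uniqueness.
Variables (R : idomainType) (n : nat).

Definition part_counts (la : seq nat) : 'X_{1..n} :=
  [multinom count_mem i.+1 la | i < n].

Lemma part_counts_inj (la mu : seq nat) : is_partition n la -> is_partition n mu ->
  part_counts la = part_counts mu -> la = mu.
Proof.
move=> /and3P[sla la0 /eqP nla] /and3P[smu mu0 /eqP nmu] E.
apply: geq_sorted_perm_eq => //; apply/allP => x; rewrite mem_cat => xin /=.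
have x0 : x != 0%N by apply: contraTneq xin => ->; rewrite negb_or la0 mu0.
have xn : (x <= n)%N.
  by case/orP: xin => /mem_le_sumn; rewrite ?nla ?nmu.
case: x x0 xn {xin} => // x _ xn.
by have /mnmP/(_ (Ordinal xn)) := E; rewrite !mnmE => ->.
Qed.

Lemma prod_mesymE (la : seq nat) : is_partition n la ->
  \prod_(k <- la) mesym n R k
  = 'X_[part_counts la] \mPo [tuple mesym n R i.+1 | i < n].
Proof.
move=> /and3P[_ la0 /eqP nla]; rewrite comp_mpolyX.
under [RHS]eq_bigr do rewrite mnmE tnth_mktuple.
have : {in la, forall k, 0 < k <= n}%N.
  move=> k kla; rewrite -nla mem_le_sumn // andbT lt0n.
  by apply: contraNneq la0 => <-.
elim: la {la0 nla} => [|k la IH] H; first by rewrite big_nil big1.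
rewrite big_cons IH => [|j jla]; last by apply: H; rewrite inE jla orbT.
under [RHS]eq_bigr do rewrite /= exprD.
rewrite big_split /=; congr (_ * _).
have /andP[k0 kn] := H k (mem_head _ _).
have k1n : (k.-1 < n)%N by rewrite prednK.
rewrite (bigD1 (Ordinal k1n)) //= prednK // eqxx expr1 big1 ?mulr1 // => i.
rewrite -val_eqE /= => ik; case: eqP => // kE; by rewrite kE eqxx in ik.
Qed.

(** Partitions of n only have parts up to n and give distinct monomials in
e_1, ..., e_n, which are algebraically independent. *)
Lemma elementary_free (c c' : seq nat -> R) :
  \sum_(la <- partitions n) c la *: \prod_(k <- la) mesym n R k
    = \sum_(la <- partitions n) c' la *: \prod_(k <- la) mesym n R k ->
  forall la, is_partition n la -> c la = c' la.
Proof.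
pose t (d : seq nat -> R) : {mpoly R[n]} :=
  \sum_(la <- partitions n) d la *: 'X_[part_counts la].
have tE d : \sum_(la <- partitions n) d la *: \prod_(k <- la) mesym n R k
    = t d \mPo [tuple mesym n R i.+1 | i < n].
  rewrite raddf_sum; apply: eq_big_seq => la.
  by rewrite mem_partitions => la_n; rewrite /= comp_mpolyZ prod_mesymE.
rewrite !tE => /msym_fundamental_un tt la la_n.
have tla d : (t d)@_(part_counts la) = d la.
  have la_in : la \in partitions n by rewrite mem_partitions.
  rewrite raddf_sum (bigD1_seq la) ?partitions_uniq //= mcoeffZ mcoeffX eqxx mulr1.
  rewrite big_seq_cond big1 ?addr0 // => mu /andP[+ mula]; rewrite mem_partitions => mu_n.
  rewrite mcoeffZ mcoeffX; case: eqP => [/(part_counts_inj mu_n la_n) E|_]; last by rewrite mulr0.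
  by rewrite E eqxx in mula.
by rewrite -tla tt tla.
Qed.

End Uniqueness.

Definition hook_coef n (la : seq nat) : {poly int} :=
  \sum_(s <- hook_seqs n n | compatible_seq s && (sort geq (map hook_len s) == la))
    'X ^+ des (hook_concat s).

(** Both sums are indexed by the same words of columns, each occurring once. *)
Lemma powST_hook_coef n la :
  \sum_(T in powST (@path_order n) la) ('X : {poly int}) ^+ inv_tableau (@path_order n) T
  = hook_coef n la.
Proof.
pose L := [seq s <- hook_seqs n n | compatible_seq s && (sort geq (map hook_len s) == la)].
have mem_L s : (s \in L)
  = [&& compatible_seq s, sort geq (map hook_len s) == la & sumn (map hook_len s) == n].
  by rewrite mem_filter mem_hook_seqs // andbA.
have perm_words : perm_eq [seq column_word T | T <- enum (powST (@path_order n) la)]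
                          [seq hook_concat s | s <- L].
  apply: uniq_perm.
  - rewrite map_inj_in_uniq ?enum_uniq // => T U; rewrite !mem_enum.
    exact: column_word_inj.
  - rewrite map_inj_in_uniq ?filter_uniq ?uniq_hook_seqs // => s s'.
    by rewrite !mem_L => /andP[vs _] /andP[vs' _]; apply: hook_concat_inj.
  move=> w; apply/mapP/mapP => [[T]|[s]].
    rewrite mem_enum => /powST_word[s [vs sn sla Ts]] ->; exists s => //.
    by rewrite mem_L vs sla sn !eqxx.
  rewrite mem_L => /and3P[vs /eqP sla /eqP sn] ->; subst la.
  by have [T Tpow Ts] := word_powST vs sn; exists T; rewrite ?mem_enum.
transitivity (\sum_(w <- [seq column_word T | T <- enum (powST (@path_order n) la)])
    ('X : {poly int}) ^+ des w).
  rewrite big_map big_enum; apply: eq_bigr => T /powSTP[_ /standard_bij Tbij _].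
  by rewrite inv_tableau_des.
by rewrite (perm_big _ perm_words) big_map big_filter.
Qed.

(** Chromatic polynomials and hook sequences obey the same recurrence; the terms
are then grouped by the partition that the hook sizes form. *)
Lemma hook_coef_expansion n : e_expansion (inc (@path_order n)) (hook_coef n).
Proof.
move=> N; rewrite chromatic_word_sum.
pose q : {mpoly {poly int}[N]} := ('X : {poly int})%:MP.
have q1 : q != 1.
  by rewrite -[1]mpolyC1 mpolyC_eq -subr_eq0 -polyC1 polyXsubC_eq0.
have e0 k : esum (fun i : 'I_N => 'X_i : {mpoly {poly int}[N]}) k = mesym N {poly int} k.
  by [].
rewrite -(@sum_hook_seqs _ q (mesym N {poly int}) (word_sum q (fun i => 'X_i)) _ _ n n) //;
  last first.
  by move=> m m0; rewrite word_sum_rec.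
have weightE s : hook_seq_weight q s =
    if compatible_seq s then ('X ^+ des (hook_concat s))%:MP else 0.
  by rewrite /hook_seq_weight rmorphXn.
transitivity (\sum_(s <- hook_seqs n n | compatible_seq s)
   'X ^+ des (hook_concat s) *: elementary N (sort geq (map hook_len s))).
  rewrite [RHS]big_mkcond; apply: eq_bigr => s _; rewrite weightE.
  case: ifP => _; last by rewrite mul0r.
  by rewrite mul_mpolyC /elementary (perm_big _ (permEl (perm_sort _ _))).
rewrite /hook_coef; under [RHS]eq_bigr do rewrite scaler_suml big_mkcond.
rewrite exchange_big /= [LHS]big_mkcond; apply: eq_big_seq => s.
rewrite mem_hook_seqs // => /eqP sn; case: (compatible_seq s) => /=; last by rewrite big1.
have la_in : sort geq (map hook_len s) \in partitions n.
  rewrite mem_partitions /is_partition sort_geq_sorted mem_sort.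
  rewrite (perm_sumn (permEl (perm_sort _ _))) sn eqxx andbT.
  by apply/mapP => -[p _].
rewrite (bigD1_seq _ la_in) ?partitions_uniq //= eqxx big1 ?addr0 // => mu.
by rewrite eq_sym => /negbTE ->.
Qed.

Theorem theorem1p10 (n : nat) :
  (exists c : seq nat -> {poly int}, e_expansion (inc (@path_order n)) c) /\
  (forall c : seq nat -> {poly int}, e_expansion (inc (@path_order n)) c ->
   forall la : seq nat, is_partition n la ->
   c la = \sum_(T in powST (@path_order n) la)
             ('X : {poly int}) ^+ inv_tableau (@path_order n) T).
Proof.
split=> [|c cexp la la_n]; first by exists (hook_coef n); apply: hook_coef_expansion.
rewrite powST_hook_coef; apply: elementary_free la_n.
by rewrite -[LHS](cexp n) -[RHS](hook_coef_expansion n).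
Qed.
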